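(* Let $a,b\in\mathbb{C}$ be such that $\{a^kb^l : k,l\in\mathbb{N}\}$ is dense in $\mathbb{C}$ and let $c\in\mathbb{C}$ with $|c|>1$. For $1\leq p\leq\infty$ consider the diagonal operators $T_1,T_2:l^p(\mathbb{N})\to l^p(\mathbb{N})$ defined by \[T_1(x_1,x_2,x_3,\ldots)=(ax_1,cx_2,cx_3,\ldots),\qquad T_2(x_1,x_2,x_3,\ldots)=(bx_1,cx_2,cx_3,\ldots)\] for $x=(x_1,x_2,x_3,\ldots)\in l^p(\mathbb{N})$. Then $(T_1,T_2)$ is a locally hypercyclic, non-hypercyclic pair in $l^p(\mathbb{N})$ for every $1\leq p<\infty$, and $(T_1,T_2)$ is a locally topologically transitive, non-topologically transitive pair in $l^\infty(\mathbb{N})$. In particular, \[\{x\in l^p(\mathbb{N}) : J_{(T_1,T_2)}(x)=l^p(\mathbb{N})\}=\{(x_1,0,0,\ldots) : x_1\in\mathbb{C}\}\] for every $1\leq p\leq\infty$.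
   Context: Here $\mathbb{N}=\{1,2,3,\ldots\}$; $l^p(\mathbb{N})$, $1\le p<\infty$, is the Banach space of $p$-summable complex sequences and $l^\infty(\mathbb{N})$ the Banach space of bounded complex sequences. Let $(T_1,T_2)$ be a pair of commuting continuous linear operators on a Banach space $X$. The pair is hypercyclic if there exists $x\in X$ such that $\{T_1^{k_1}T_2^{k_2}x : k_1,k_2\in\mathbb{N}\cup\{0\}\}$ is dense in $X$. It is topologically transitive if for every pair $(U,V)$ of non-empty open sets in $X$ there exist $k_1,k_2\in\mathbb{N}\cup\{0\}$ with $T_1^{k_1}T_2^{k_2}(U)\cap V\neq\emptyset$. For $x\in X$, the extended limit set $J_{(T_1,T_2)}(x)$ is the set of all $y\in X$ for which there exist a sequence of vectors $x_m\to x$ in $X$ and sequences of non-negative integers $\{k_m^{(1)}\}_{m\in\mathbb{N}}$, $\{k_m^{(2)}\}_{m\in\mathbb{N}}$ with $k_m^{(1)}+k_m^{(2)}\to+\infty$ such that $T_1^{k_m^{(1)}}T_2^{k_m^{(2)}}x_m\to y$. The pair is locally topologically transitive if there exists $x\in X\setminus\{0\}$ with $J_{(T_1,T_2)}(x)=X$; if in addition $X$ is separable, the pair is called locally hypercyclic. *)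

(* Defs.v *)
From HB Require Import structures.
From mathcomp Require Import all_boot all_order all_algebra.
From mathcomp Require Import all_classical all_reals all_analysis.
From mathcomp Require Import ess_sup_inf.
From mathcomp Require Import complex.

Set Implicit Arguments.
Unset Strict Implicit.
Unset Printing Implicit Defensive.

Import Order.TTheory GRing.Theory Num.Theory numFieldNormedType.Exports.

Local Open Scope ring_scope.
Local Open Scope classical_set_scope.

Section LpNorm.
Variables (R : realType) (p : \bar R).
Implicit Types x y : nat -> R[i].
Local Notation normc := (@Normc.normc R).

(* On nat with the counting measure, the library's L^p norm is
   (\sum_k |x k| ^ p) ^ (1 / p) for finite p, and the supremum of the |x k|
   for p = +oo (lemmas lp_norm_EFin and lp_norm_pinfty). *)
Definition lp_norm x : \bar R :=
  'N[@counting nat R]_p[EFin \o (normc \o x)].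

Lemma lp_norm_ge0 x : (0 <= lp_norm x)%E.
Proof. exact: Lnorm_ge0. Qed.

Lemma normc_ge0 (z : R[i]) : 0 <= normc z.
Proof. by rewrite -ler0c; exact: (@normr_ge0 _ R[i]). Qed.

Lemma counting_setT_gt0 : (0 < @counting nat R setT)%E.
Proof.
rewrite /counting; case: asboolP => // fT.
by case: infinite_nat.
Qed.

Lemma counting_aeP (P : nat -> Prop) :
  (\forall n \ae (@counting nat R), P n) -> forall n, P n.
Proof.
move=> [A [_ A0 PA]] n; apply: contrapT => Pn; have An := PA n Pn.
suff : (1%E <= @counting nat R A)%E by rewrite A0 lee_fin ler10.
have <- : @counting nat R [set n] = 1%E.
  rewrite /counting asboolT; last exact: finite_set1.
  by rewrite fset_set1 finmap.cardfs1.
by apply: le_measure; rewrite ?inE// => _ ->.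
Qed.

Hypothesis p1 : (1 <= p)%E.

Lemma le_lp_norm x y : (forall n, normc (x n) <= normc (y n)) ->
  (lp_norm x <= lp_norm y)%E.
Proof.
move=> xy; rewrite /lp_norm; case: p p1 => [r r1| |//].
  have r0 : 0 < r by exact: lt_le_trans ltr01 r1.
  rewrite !Lnorm_counting//; apply: gt0_ler_poweR.
  - by rewrite invr_ge0 ltW.
  - by rewrite in_itv/= leey nneseries_ge0// => n _ _; rewrite poweR_ge0.
  - by rewrite in_itv/= leey nneseries_ge0// => n _ _; rewrite poweR_ge0.
  apply: lee_nneseries => n _; first by rewrite poweR_ge0.
  rewrite /= lee_fin ge0_ler_powR ?nnegrE ?(ltW r0)//.
  by rewrite !ger0_norm ?normc_ge0.
move=> _; rewrite unlock /Lnorm counting_setT_gt0.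
apply: le_ess_sup; apply: nearW => n /=.
by rewrite lee_fin !ger0_norm ?normc_ge0.
Qed.

Lemma lp_norm0 : lp_norm 0 = 0%E.
Proof.
rewrite /lp_norm (_ : EFin \o _ = cst 0%E); last first.
  by apply/funext => n; congr EFin; exact: Normc.normc0.
by rewrite Lnorm0// gt_eqF// (lt_le_trans _ p1).
Qed.

Lemma lp_normD x y : (lp_norm (x + y)%R <= lp_norm x + lp_norm y)%E.
Proof.
pose f := normc \o x; pose g := normc \o y.
apply: le_trans (@eminkowski _ _ _ (@counting nat R) f g p _ _ p1) => //.
have -> : ('N[@counting nat R]_p[EFin \o (f \+ g)%R])%E =
    lp_norm (fun n => ((f n + g n)%:C)%C).
  apply: eq_Lnorm => n /=; congr EFin.
  by rewrite expr0n/= addr0 sqrtr_sqr ger0_norm ?addr_ge0 ?normc_ge0.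
apply: le_lp_norm => n /=.
rewrite expr0n/= addr0 sqrtr_sqr ger0_norm ?addr_ge0 ?normc_ge0//.
exact: le_normcD.
Qed.

Lemma lp_normZ (a : R[i]) x :
  lp_norm (fun n => a * x n) = ((normc a)%:E * lp_norm x)%E.
Proof.
rewrite /lp_norm; case: p p1 => [r r1| |//].
  have r0 : 0 < r by exact: lt_le_trans ltr01 r1.
  rewrite !Lnorm_counting//.
  under eq_eseriesr.
    move=> n _; rewrite /= Normc.normcM normrM powRM// EFinM.
    rewrite (ger0_norm (normc_ge0 a)); over.
  rewrite nneseriesZl; last by move=> n _; rewrite lee_fin powR_ge0.
  rewrite poweRM ?lee_fin ?powR_ge0//; last first.
    by apply: nneseries_ge0 => n _ _; rewrite lee_fin powR_ge0.
  by rewrite poweR_EFin -powRrM mulfV ?gt_eqF// powRr1 ?normc_ge0.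
move=> _; rewrite unlock /Lnorm counting_setT_gt0 -ess_supZl ?normc_ge0//.
  apply/eq_ess_sup/nearW => n /=.
  by rewrite Normc.normcM normrM EFinM (ger0_norm (normc_ge0 a)).
exact: counting_setT_gt0.
Qed.

Lemma normc_le_lp_norm x k : ((normc (x k))%:E <= lp_norm x)%E.
Proof.
rewrite /lp_norm; case: p p1 => [r r1| |//].
  have r0 : 0 < r by exact: lt_le_trans ltr01 r1.
  rewrite Lnorm_counting//.
  have -> : (normc (x k))%:E = (((normc (x k))%:E `^ r) `^ r^-1)%E.
    by rewrite -poweRrM mulfV ?gt_eqF// poweRe1// lee_fin normc_ge0.
  have xr n : (0 <= `|(EFin \o (normc \o x)) n| `^ r)%E by rewrite poweR_ge0.
  apply: gt0_ler_poweR.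
  - by rewrite invr_ge0 ltW.
  - by rewrite in_itv/= leey lee_fin powR_ge0.
  - by rewrite in_itv/= leey nneseries_ge0.
  apply: le_trans (nneseries_lim_ge k.+1 _) => //.
  rewrite big_nat_recr//= ger0_norm ?normc_ge0// leeDr// sume_ge0//.
move=> _; rewrite unlock /Lnorm counting_setT_gt0.
have /counting_aeP/(_ k) :=
  ess_sup_ge (@counting nat R) (abse \o (EFin \o (normc \o x))).
by rewrite /= ger0_norm ?normc_ge0.
Qed.

Definition truncate n x : nat -> R[i] := fun k => if (k < n)%N then x k else 0.

Lemma lp_norm_truncate_le x M :
  (forall n, (lp_norm (truncate n x) <= M)%E) -> (lp_norm x <= M)%E.
Proof.
move=> xM; have [->|Moo] := eqVneq M +oo%E; first by rewrite leey.
have M0 : (0 <= M)%E := le_trans (lp_norm_ge0 _) (xM 0).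
case: M xM Moo M0 => [M| |]// xM _ M0.
move: xM; rewrite /lp_norm; case: p p1 => [r r1| |//].
  have r0 : 0 < r by exact: lt_le_trans ltr01 r1.
  rewrite Lnorm_counting// => xM.
  have -> : (M%:E = ((M%:E `^ r) `^ r^-1))%E.
    by rewrite -poweRrM mulfV ?gt_eqF// poweRe1// lee_fin normc_ge0.
  have xr y n : (0 <= `|(EFin \o (normc \o y)) n| `^ r)%E by rewrite poweR_ge0.
  apply: gt0_ler_poweR.
  - by rewrite invr_ge0 ltW.
  - by rewrite in_itv/= leey nneseries_ge0.
  - by rewrite in_itv/= leey lee_fin powR_ge0.
  apply: lime_le; first exact: is_cvg_nneseries.
  apply: nearW => n; have := xM n; rewrite Lnorm_counting//.
  move=> /(gt0_ler_poweR (ltW r0)); rewrite !in_itv/= !leey !andbT.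
  rewrite poweR_ge0 -poweRrM mulVf ?gt_eqF// poweRe1; last first.
    by rewrite nneseries_ge0.
  move=> /(_ isT M0); apply: le_trans.
  apply: le_trans (nneseries_lim_ge n _) => //.
  rewrite !big_nat; apply: lee_sum => k /andP[_ kn].
  by rewrite /= /truncate kn.
move=> _ xM; rewrite unlock /Lnorm counting_setT_gt0.
apply/ess_supP/nearW => n /=; rewrite ger0_norm ?normc_ge0//.
have := xM n.+1; rewrite unlock /Lnorm counting_setT_gt0.
move=> /ess_supP/counting_aeP/(_ n)/=.
by rewrite /truncate ltnSn ger0_norm ?normc_ge0.
Qed.

End LpNorm.

Lemma lp_norm_EFin (R : realType) (r : R) (x : nat -> R[i]) : 0 < r ->
  lp_norm r%:E x =
  ((\sum_(k <oo) (Normc.normc (x k) `^ r)%:E) `^ r^-1)%E.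
Proof.
move=> r0; rewrite /lp_norm Lnorm_counting//; congr (_ `^ _)%E.
apply: eq_eseriesr => k _.
by rewrite /= ger0_norm ?normc_ge0.
Qed.

Lemma lp_norm_pinfty (R : realType) (x : nat -> R[i]) :
  lp_norm +oo%E x = ereal_sup (range (fun k => (Normc.normc (x k))%:E)).
Proof.
apply/eqP; rewrite eq_le; apply/andP; split; last first.
  by apply: ge_ereal_sup => _ [k _ <-]; apply: normc_le_lp_norm; rewrite leey.
rewrite /lp_norm unlock /Lnorm counting_setT_gt0.
apply/ess_supP/nearW => k /=; rewrite ger0_norm ?normc_ge0//.
by apply: ereal_sup_ubound; exists k.
Qed.

Section ComplexComplete.
Variable R : realType.

Lemma le_normc_ReIm (z : R[i]) :
  `|z| <= (`|complex.Re z| + `|complex.Im z|)%:C%C.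
Proof.
case: z => x y; rewrite normc_def lecR /=.
rewrite -[leRHS]ger0_norm ?addr_ge0// -sqrtr_sqr ler_wsqrtr//.
rewrite sqrrD -!normrX !(@ger0_norm _ (_ ^+ 2)) ?sqr_ge0//.
by rewrite addrAC lerDl mulrn_wge0// mulr_ge0.
Qed.

Lemma complex_complete (F : set_system R[i]^o) :
  ProperFilter F -> cauchy F -> cvg F.
Proof.
move=> FF /cauchyP Fc.
have part (f : R[i] -> R) : (forall x y, `|f x - f y|%:C%C <= `|x - y|) ->
    cvg (f @ F).
  move=> fle; apply: R_complete; apply/cauchyP => e e0.
  have [x xF] := Fc (e%:C)%C (etrans (ltcR 0 e) e0).
  exists (f x); apply: (@filterS _ F _ _ _ _ xF) => y /=.
  rewrite -!ball_normE /= => xy.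
  by rewrite -ltcR; exact: (@le_lt_trans _ R[i] _ _ _ (fle x y)).
have /cvg_ex[a Fa] := part (@complex.Re R)
  (fun x y => ltac:(by rewrite -raddfB; exact: normc_ge_Re)).
have Im_le (x y : R[i]) : `|complex.Im x - complex.Im y|%:C%C <= `|x - y|.
  rewrite -raddfB normc_def lecR -[leLHS]sqrtr_sqr ler_wsqrtr//.
  by rewrite lerDr sqr_ge0.
have /cvg_ex[b Fb] := part (@complex.Im R) Im_le.
apply/cvg_ex; exists ((a +i* b)%C : R[i]^o).
apply/cvgrPdist_le => -[e e'] /=; rewrite ltcE/= => /andP[/eqP -> e0].
move/cvgrPdist_le/(_ (e / 2)) : Fa => /(_ ltac:(by rewrite divr_gt0)) Fa.
move/cvgrPdist_le/(_ (e / 2)) : Fb => /(_ ltac:(by rewrite divr_gt0)) Fb.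
near=> z.
apply: (@le_trans _ R[i] _ _ _ (le_normc_ReIm _)).
rewrite lecR !raddfB /=.
rewrite [leRHS]splitr; apply: lerD; near: z; [exact: Fa|exact: Fb].
Unshelve. all: by end_near. Qed.

End ComplexComplete.

Section LpSpace.
Variables (R : realType) (p : \bar R).

Definition lp_pred : {pred nat -> R[i]^o} :=
  mem [set x : nat -> R[i]^o | (lp_norm p x < +oo)%E].

(* p1 is a phantom parameter: the normed-module structure below needs 1 <= p.
   The scalar field is R[i], whose library topology is carried by R[i]^o; the
   norm of lp takes its values in R[i] as the library requires. *)
Record lp (p1 : (1 <= p)%E) := Lp {
  lp_fun :> nat -> R[i]^o;
  lp_funP : lp_fun \in lp_pred
}.

Variable p1 : (1 <= p)%E.

HB.instance Definition _ := [isSub of lp p1 for @lp_fun p1].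
HB.instance Definition _ := [Choice of lp p1 by <:].

Lemma lp_submod_closed : submod_closed lp_pred.
Proof.
split; first by rewrite inE/= lp_norm0.
move=> a x y; rewrite !inE/= => xoo yoo.
apply: le_lt_trans (lp_normD p1 (a *: x) y) _.
rewrite lte_add_pinfty//.
have -> : lp_norm p (a *: x) = ((Normc.normc a)%:E * lp_norm p x)%E.
  exact: lp_normZ.
by rewrite lte_mul_pinfty// lee_fin normc_ge0.
Qed.

HB.instance Definition _ :=
  GRing.isSubmodClosed.Build _ _ lp_pred lp_submod_closed.
HB.instance Definition _ := [SubChoice_isSubLmodule of lp p1 by <:].

Implicit Types x y : lp p1.

Lemma lpP x y : (forall n, x n = y n) -> x = y.
Proof. by move=> xy; apply/val_inj/funext. Qed.

Lemma lp_norm_lty x : (lp_norm p x < +oo)%E.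
Proof. by have := lp_funP x; rewrite inE. Qed.

Lemma lp_norm_fin x : lp_norm p x \is a fin_num.
Proof. by rewrite ge0_fin_numE ?lp_norm_ge0// lp_norm_lty. Qed.

Definition lp_normr x : R[i] := ((fine (lp_norm p x))%:C)%C.

Lemma ler_lp_normrD x y : lp_normr (x + y) <= lp_normr x + lp_normr y.
Proof.
rewrite /lp_normr -rmorphD/= lecR -lee_fin EFinD !fineK ?lp_norm_fin//.
  exact: lp_normD.
exact: (lp_norm_fin (x + y)).
Qed.

Lemma lp_normrZ (a : R[i]) x : lp_normr (a *: x) = `|a| * lp_normr x.
Proof.
rewrite /lp_normr -[`|a|]/((Normc.normc a)%:C)%C -rmorphM/=; congr (_%:C)%C.
apply: EFin_inj; rewrite EFinM !fineK ?lp_norm_fin//.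
  exact: lp_normZ.
exact: (lp_norm_fin (a *: x)).
Qed.

Lemma lp_normr0_eq0 x : lp_normr x = 0 -> x = 0.
Proof.
move=> [x0]; apply: lpP => n; apply: Normc.eq0_normc; apply/eqP.
rewrite eq_le normc_ge0 andbT -lee_fin (le_trans (normc_le_lp_norm p1 x n))//.
by rewrite -(fineK (lp_norm_fin x)) x0.
Qed.

HB.instance Definition _ := Lmodule_isNormed.Build R[i] (lp p1)
  ler_lp_normrD lp_normrZ lp_normr0_eq0.

Lemma lp_normrE x : `|x| = ((fine (lp_norm p x))%:C)%C.
Proof. by []. Qed.

Lemma lpDE x y n : (x + y) n = x n + y n. Proof. by []. Qed.
Lemma lpNE x n : (- x) n = - x n. Proof. by []. Qed.
Lemma lpBE x y n : (x - y) n = x n - y n. Proof. by []. Qed.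
Lemma lpZE (a : R[i]) x n : (a *: x) n = a * x n. Proof. by []. Qed.

Lemma norm_coord_le x n : `|x n| <= `|x| :> R[i].
Proof.
rewrite lp_normrE -[leLHS]/((Normc.normc (x n))%:C)%C lecR -lee_fin.
by rewrite fineK ?lp_norm_fin ?normc_le_lp_norm.
Qed.

Let one : nat -> R[i] := fun=> 1.

Lemma lp_norm_truncate1 n : (lp_norm p (truncate n one) < +oo)%E.
Proof.
rewrite /lp_norm; case: p p1 => [r r1| |//].
  have r0 : 0 < r by exact: lt_le_trans ltr01 r1.
  rewrite Lnorm_counting// poweR_lty//.
  rewrite (nneseries_split _ n); last by move=> k _; rewrite poweR_ge0.
  rewrite (eseries0 (N := 0 + n)); last first.
    move=> k; rewrite add0n leqNgt => nk _ /=.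
    by rewrite /truncate (negPf nk) Normc.normc0 normr0 powR0// gt_eqF.
  rewrite adde0 add0n; apply: lte_sum_pinfty => k _.
  by rewrite poweR_EFin ltry.
move=> _; rewrite unlock /Lnorm counting_setT_gt0.
apply: le_lt_trans (ltry 1); apply/ess_supP/nearW => k /=.
rewrite lee_fin ger0_norm ?normc_ge0// /truncate.
by case: ifP => _; rewrite ?Normc.normc1 ?Normc.normc0.
Qed.

Lemma lp_complete (F : set_system (lp p1)) : ProperFilter F -> cauchy F -> cvg F.
Proof.
move=> FF /cauchyP Fc.
have coord n : cvg ((fun x : lp p1 => x n) @ F).
  apply: complex_complete; apply/cauchyP => e e0.
  have [x xF] := Fc e e0; exists (x n).
  apply: (@filterS _ F _ _ _ _ xF) => y /=.
  rewrite -!ball_normE /=; apply: le_lt_trans.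
  by rewrite -lpBE; exact: norm_coord_le.
pose y n : R[i]^o := lim ((fun x : lp p1 => x n) @ F).
have bnd u (e : R) : 0 < e -> F (ball u (e%:C)%C) ->
    (lp_norm p (fun n => u n - y n : R[i])%R <= e%:E)%E.
  move=> e0 Fu; apply: lp_norm_truncate_le => // n.
  apply/lee_addgt0Pr => d d0.
  set C := fine (lp_norm p (truncate n one)).
  have C0 : 0 <= C by rewrite fine_ge0 ?lp_norm_ge0.
  have dC0 : 0 < d / (C + 1) by rewrite divr_gt0 ?ltr_wpDl.
  near F => v.
  have uv : (lp_norm p (fun n => u n - v n : R[i])%R <= e%:E)%E.
    have : ball u (e%:C)%C v by near: v; exact: Fu.
    rewrite -ball_normE/= lp_normrE ltcR => /ltW.
    by rewrite -lee_fin fineK//; exact: (lp_norm_fin (u - v)).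
  have vy : forall k : 'I_n, `|y k - v k| <= ((d / (C + 1))%:C)%C.
    near: v; apply: filter_forall => k.
    have /cvgrPdist_le/(_ ((d / (C + 1))%:C)%C) := coord k.
    by apply; rewrite ltcR.
  have -> : truncate n (fun n => u n - y n) =
      (truncate n (fun n => u n - v n : R[i]) +
       truncate n (fun n => v n - y n : R[i]))%R.
    apply/funext => k; rewrite /truncate.
    change ((if (k < n)%N then u k - y k else 0) =
      (if (k < n)%N then u k - v k else 0) +
      (if (k < n)%N then v k - y k else 0)).
    by case: ifP => _; [rewrite subrKA|rewrite addr0].
  apply: le_trans (lp_normD p1 _ _) _; apply: leeD.
    apply: le_trans uv; apply: le_lp_norm => // k; rewrite /truncate.
    by case: ifP => // _; rewrite Normc.normc0 normc_ge0.
  apply: (@le_trans _ _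
      (lp_norm p (fun k => ((d / (C + 1))%:C)%C * truncate n one k))).
    apply: le_lp_norm => // k; rewrite /truncate; case: ifP => [kn|_].
      rewrite mulr1 -lecR [leRHS](_ : _ = ((d / (C + 1))%:C)%C).
        have := vy (Ordinal kn); rewrite distrC; exact.
      by rewrite -[RHS](@ger0_norm R[i])// lecR ltW.
    by rewrite mulr0.
  rewrite lp_normZ// -(@fineK _ (lp_norm p (truncate n one))); last first.
    by rewrite ge0_fin_numE ?lp_norm_ge0// lp_norm_truncate1.
  rewrite -/C -EFinM lee_fin.
  have -> : Normc.normc ((d / (C + 1))%:C)%C = d / (C + 1).
    by rewrite /= expr0n/= addr0 sqrtr_sqr ger0_norm// ltW.
  by rewrite mulrAC ler_pdivrMr ?ltr_wpDl// ler_pM2l// lerDl.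
have [u1 Fu1] := Fc 1 ltr01.
have ylp : y \in lp_pred.
  have uylp : (fun n => u1 n - y n : R[i]^o) \in lp_pred.
    by rewrite inE/=; apply: le_lt_trans (bnd u1 1 ltr01 Fu1) (ltry _).
  have -> : y = (u1 : nat -> R[i]^o) - (fun n => u1 n - y n : R[i]^o).
    apply/funext => n; change (y n = u1 n - (u1 n - y n)).
    by rewrite opprB subrKC.
  by apply: rpredB => //; exact: lp_funP.
apply/cvg_ex; exists (Lp p1 ylp).
apply/cvgrPdist_le => -[e e'] /=; rewrite ltcE/= => /andP[/eqP -> e0].
have e20 : 0 < e / 2 by rewrite divr_gt0.
have [u Fu] := Fc ((e / 2)%:C)%C (etrans (ltcR 0 (e / 2)) e20).
near=> v.
rewrite distrC (_ : v - _ = (u - Lp p1 ylp) - (u - v)); last first.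
  by rewrite opprB [RHS]addrC subrKA.
apply: le_trans (ler_normB _ _) _.
rewrite [leRHS](_ : _ = ((e / 2)%:C)%C + ((e / 2)%:C)%C); last first.
  by rewrite -rmorphD/= -splitr.
apply: lerD.
  rewrite lp_normrE lecR -lee_fin fineK; last exact: (lp_norm_fin (u - _)).
  exact: bnd.
by apply: ltW; have : ball u ((e / 2)%:C)%C v by near: v; exact: Fu.
Unshelve. all: by end_near. Qed.

HB.instance Definition _ := Uniform_isComplete.Build (lp p1) lp_complete.


End LpSpace.

Section DiagonalOperator.
Variables (R : realType) (p : \bar R) (p1 : (1 <= p)%E) (a c : R[i]).
Implicit Types x y : lp p1.

(* The coordinates x_1, x_2, ... are x 0, x 1, ... *)
Definition diag_seq (x : nat -> R[i]^o) : nat -> R[i]^o :=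
  fun n => if n == 0%N then a * x 0%N else c * x n.

Let bound : R := Normc.normc a + Normc.normc c.

Lemma diag_seq_norm (x : nat -> R[i]^o) :
  (lp_norm p (diag_seq x) <= bound%:E * lp_norm p x)%E.
Proof.
have b0 : 0 <= bound by rewrite addr_ge0 ?normc_ge0.
have -> : bound%:E = (Normc.normc ((bound%:C)%C : R[i]))%:E.
  by rewrite /= expr0n/= addr0 sqrtr_sqr ger0_norm.
rewrite -lp_normZ//; apply: le_lp_norm => // n.
rewrite Normc.normcM [X in _ <= X * _](_ : _ = bound); last first.
  by rewrite /= expr0n/= addr0 sqrtr_sqr ger0_norm.
rewrite /diag_seq; case: eqP => [->|_]; rewrite Normc.normcM.
  by rewrite ler_wpM2r ?normc_ge0// lerDl normc_ge0.
by rewrite ler_wpM2r ?normc_ge0// lerDr normc_ge0.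
Qed.

Lemma diag_seq_lp x : diag_seq x \in lp_pred p.
Proof.
rewrite inE/=; apply: le_lt_trans (diag_seq_norm x) _.
by rewrite lte_mul_pinfty ?lee_fin ?addr_ge0 ?normc_ge0// lp_norm_lty.
Qed.

Definition diag_op x : lp p1 := Lp p1 (diag_seq_lp x).

Lemma diag_op_linear : linear diag_op.
Proof.
move=> k x y; apply: lpP => n; 
change (diag_seq (k *: x + y) n = k * diag_seq x n + diag_seq y n :> R[i]).
rewrite /diag_seq; case: ifP => _.
  change (a * (k * x 0%N + y 0%N) = k * (a * x 0%N) + a * y 0%N :> R[i]).
  by rewrite mulrDr mulrCA.
change (c * (k * x n + y n) = k * (c * x n) + c * y n :> R[i]).
by rewrite mulrDr mulrCA.
Qed.

HB.instance Definition _ := GRing.isLinear.Build R[i] (lp p1) (lp p1) _ diag_op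
  diag_op_linear.

Lemma diag_op_continuous : continuous diag_op.
Proof.
apply: bounded_linear_continuous; apply/linear_boundedP.
exists (bound%:C)%C; split; first by rewrite realE/= lecR addr_ge0 ?normc_ge0.
move=> M bM x; apply: (@le_trans _ _ ((bound%:C)%C * `|x|)); last first.
  by rewrite ler_wpM2r// ltW.
rewrite !lp_normrE -rmorphM/= lecR -lee_fin EFinM.
rewrite !fineK ?lp_norm_fin//; last exact: (lp_norm_fin (diag_op x)).
exact: diag_seq_norm.
Qed.

End DiagonalOperator.

Section OperatorPairs.
Variables (K : numFieldType) (X : completeNormedModType K).

Record operator_pair := OperatorPair {
  op1 : {linear X -> X};
  op2 : {linear X -> X};
  op1_continuous : continuous op1;
  op2_continuous : continuous op2;
  op_commute : forall x, op1 (op2 x) = op2 (op1 x)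
}.

Variable T : operator_pair.

Definition pair_iter (k1 k2 : nat) (x : X) : X :=
  iter k1 (op1 T) (iter k2 (op2 T) x).

Definition pair_orbit (x : X) : set X :=
  [set y | exists k1 k2 : nat, y = pair_iter k1 k2 x].

Definition hypercyclic := exists x : X, dense (pair_orbit x).

Definition topologically_transitive :=
  forall U V : set X, open U -> U !=set0 -> open V -> V !=set0 ->
  exists k1 k2 : nat, (pair_iter k1 k2 @` U) `&` V !=set0.

Definition extended_limit_set (x : X) : set X :=
  [set y | exists (u : nat -> X) (k1 k2 : nat -> nat),
    [/\ u m @[m --> \oo] --> x,
        (k1 m + k2 m)%N @[m --> \oo] --> \oo &
        pair_iter (k1 m) (k2 m) (u m) @[m --> \oo] --> y]].

Definition locally_topologically_transitive :=
  exists2 x : X, x != 0 & extended_limit_set x = setT.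

Definition separable (Y : topologicalType) :=
  exists2 D : set Y, countable D & dense D.

Definition locally_hypercyclic :=
  locally_topologically_transitive /\ separable X.

End OperatorPairs.

Section DiagonalPair.
Variables (R : realType) (p : \bar R) (p1 : (1 <= p)%E) (a b c : R[i]).

Lemma diag_op_commute (x : lp p1) :
  diag_op a c (diag_op b c x) = diag_op b c (diag_op a c x).
Proof.
apply: lpP => n; rewrite /= /diag_seq /=; case: (n == 0%N);
  exact: (@mulrCA R[i]).
Qed.

Definition diag_pair : operator_pair (lp p1) :=
  @OperatorPair R[i] (lp p1) (diag_op a c) (diag_op b c)
    (@diag_op_continuous R p p1 a c) (@diag_op_continuous R p p1 b c)
    diag_op_commute.

End DiagonalPair.

(* Main.v *)
Require Import Defs.
From mathcomp Require Import all_boot all_order all_algebra.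
From mathcomp Require Import all_classical all_reals all_analysis.
From mathcomp Require Import complex.
From mathcomp Require Import lra.
Import Order.TTheory GRing.Theory Num.Theory numFieldNormedType.Exports.
Local Open Scope ring_scope.
Local Open Scope classical_set_scope.

(** The operator T1^k T2^l multiplies the first coordinate by a^k b^l and every
    other coordinate by c^(k+l).  The two kinds of coordinates behave in
    opposite ways, and this explains all the claims.

    On the coordinates after the first, iteration expands.  A vector whose
    second coordinate is near 1 is therefore never sent near 0, which excludes
    topological transitivity, and an orbit can approach 0 only if it has second
    coordinate 0 throughout, which excludes density (pair_iter_expand).  For
    extended limit sets, if u_m -> x and T1^(k_m) T2^(l_m) u_m -> y with
    k_m + l_m -> oo, then the n-th coordinate of u_m, n >= 2, is c^-(k_m+l_m)
    times a convergent sequence, hence tends to 0: the extended limit set of x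
    is empty unless x = (x_1, 0, 0, ...) (extended_limit_set_coord0).

    Conversely let x = (x_1, 0, 0, ...) and let y be any target.  Expansion can
    be undone at small cost: the vector u with first coordinate w and n-th
    coordinate c^-(k+l) y_n for n >= 2 is mapped to y except at the first
    coordinate, which becomes a^k b^l w.  When w is x_1, or a small nonzero
    number if x_1 = 0, and k + l is large, u is close to x; and k, l can be
    chosen so that a^k b^l is close to y_1 / w, by density
    (extended_limit_set_axis).  Density has to be used with k + l arbitrarily
    large; this costs nothing, as a is nonzero and multiplication by a^N is a
    homeomorphism (dense_mulX_tail).

    It remains that l^p is separable for finite p: the finitely supported
    sequences with entries in Q + iQ are dense, since the tails of a convergent
    series tend to 0 (separable_lp). *)

(** * Limits over the complex numbers *)

(** The order of R[i] relates only numbers with equal imaginary parts, so a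
    positive complex radius is a real one and real estimates apply to it. *)
Lemma gt0_complexE {R : realType} {e : R[i]} : 0 < e ->
  exists2 r : R, 0 < r & e = (r%:C)%C.
Proof.
by case: e => r i; rewrite ltcE /= => /andP[/eqP -> r0]; exists r.
Qed.

Lemma normcE {R : realType} (z : R[i]) : `|z| = ((Normc.normc z)%:C)%C.
Proof. by []. Qed.

Lemma cvg_complex_exprV {R : realType} {c : R[i]} : 1 < `|c| ->
  (c^-1 ^+ n : R[i]^o) @[n --> \oo] --> (0 : R[i]^o).
Proof.
move=> c1.
have rE : `|c^-1| = (((Normc.normc c)^-1)%:C)%C by rewrite normfV fmorphV.
have r1 : `|(Normc.normc c)^-1| < 1 :> R.
  have n1 : 1 < Normc.normc c by rewrite -ltcR -normcE.
  have n0 := lt_trans ltr01 n1.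
  by rewrite ger0_norm ?invr_ge0 ?ltW// invf_lt1.
apply/cvgr0Pnorm_lt => e /gt0_complexE[d d0 ->].
have /cvgr0Pnorm_lt/(_ d d0) := cvg_expr r1.
apply: filterS => n /=; rewrite ger0_norm ?exprn_ge0 ?invr_ge0 ?normc_ge0//.
by move=> rd; rewrite normrX rE -rmorphXn ltcR.
Qed.

Lemma cvg_dist_lt_natSinv {R : realType} {V : normedModType R[i]}
    {u : nat -> V} {x : V} :
  (forall m, `|u m - x| < ((m.+1%:R^-1 : R)%:C)%C) -> u m @[m --> \oo] --> x.
Proof.
move=> ux; apply/cvgrPdist_lt => e /gt0_complexE[d d0 ->].
have := near_infty_natSinv_lt (PosNum d0); apply: filterS => m /= md.
by rewrite distrC (lt_trans (ux m))// ltcR.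
Qed.

(** Sequences witnessing membership are extracted from approximations at the
    scales 1 / (m + 1); it is enough to produce one good vector per scale. *)
Lemma mem_extended_limit_set {R : realType} {X : completeNormedModType R[i]}
    (T : operator_pair X) (x y : X) :
  (forall (e : R[i]) (N : nat), 0 < e -> exists u k l,
    [/\ `|u - x| < e, (N <= k + l)%N & `|pair_iter T k l u - y| < e]) ->
  extended_limit_set T x y.
Proof.
move=> H.
have /choice[f fP] (m : nat) : exists ukl : X * nat * nat,
    [/\ `|ukl.1.1 - x| < ((m.+1%:R^-1 : R)%:C)%C,
        (m <= ukl.1.2 + ukl.2)%N &
        `|pair_iter T ukl.1.2 ukl.2 ukl.1.1 - y| < ((m.+1%:R^-1 : R)%:C)%C].
  have [|u [k [l ukl]]] := H ((m.+1%:R^-1 : R)%:C)%C m.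
    by rewrite ltcR.
  by exists (u, k, l).
exists (fun m => (f m).1.1), (fun m => (f m).1.2), (fun m => (f m).2).
split.
- by apply: cvg_dist_lt_natSinv => m; case: (fP m).
- apply/cvgnyPge => A; exists A => // m /= Am.
  by case: (fP m) => _ /(leq_trans Am).
- by apply: cvg_dist_lt_natSinv => m; case: (fP m).
Qed.

(** Any a^k b^l near z / a^N gives a^(N+k) b^l near z, so the products with
    large k + l are still dense. *)
Lemma dense_mulX_tail {R : realType} {a b : R[i]}
    (hab : dense [set z : R[i]^o | exists k l : nat,
                    [/\ (0 < k)%N, (0 < l)%N & z = a ^+ k * b ^+ l]])
    (N : nat) (z : R[i]) {e : R[i]} : 0 < e ->
  exists k l, (N <= k + l)%N /\ `|a ^+ k * b ^+ l - z| < e.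
Proof.
have near_pt (w d : R[i]) : 0 < d ->
    exists k l, (0 < k)%N /\ `|a ^+ k * b ^+ l - w| < d.
  move=> d0; have [||v [/= wd [k [l [k0 _ vE]]]]] :=
    hab (ball (w : R[i]^o) d).
  - by exists w; exact: ballxx.
  - exact: ball_open.
  exists k, l; split => //; move: wd.
  by rewrite vE -ball_normE /= distrC.
(* For a = 0 every product would vanish, the exponent k being positive. *)
move=> e0; have a0 : a != 0.
  apply/eqP => a0; have [k [l [k0]]] := near_pt 1 1 ltr01.
  by rewrite a0 expr0n gtn_eqF// mul0r sub0r normrN normr1 ltxx.
have aN0 : 0 < `|a ^+ N| by rewrite normr_gt0 expf_neq0.
have [k [l [_ kl]]] := near_pt (z / a ^+ N) (e / `|a ^+ N|) (divr_gt0 e0 aN0).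
exists (N + k)%N, l; split; first by rewrite -addnA leq_addr.
rewrite exprD -mulrA -{1}[z](@divfK _ (a ^+ N)) -?normr_gt0//.
by rewrite [z / _ * _]mulrC -mulrBr normrM mulrC -ltr_pdivlMr.
Qed.

(** * Finitely supported sequences and separability of l^p *)

Section FiniteSupport.
Context {R : realType} {p : \bar R} (p1 : (1 <= p)%E).

(** Comparison with a constant sequence treats all p at once: the only
    p-dependent factor is a finite constant depending on N alone. *)
Lemma lp_norm_truncate_bound {z : nat -> R[i]} {N : nat} {d : R} : 0 <= d ->
  (forall k, (k < N)%N -> Normc.normc (z k) <= d) ->
  (lp_norm p (truncate N z) <= d%:E * lp_norm p (truncate N (fun=> 1%R)))%E.
Proof.
move=> d0 zd; have dE : Normc.normc ((d%:C)%C : R[i]) = d.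
  by rewrite /= expr0n/= addr0 sqrtr_sqr ger0_norm.
rewrite -[in leRHS]dE -lp_normZ//; apply: le_lp_norm => // k.
rewrite /truncate; case: ifP => [kN|_]; last by rewrite mulr0.
by rewrite mulr1 dE zd.
Qed.

Lemma finite_support_lp {x : nat -> R[i]^o} (N : nat) :
  (forall k, (N <= k)%N -> x k = 0) -> x \in lp_pred p.
Proof.
move=> x0; rewrite inE /=.
have -> : x = truncate N x.
  by apply/funext => k; rewrite /truncate; case: ltnP => // /x0.
pose d : R := \sum_(k < N) Normc.normc (x k).
have d0 : 0 <= d by apply: sumr_ge0 => k _; exact: normc_ge0.
have xd k : (k < N)%N -> Normc.normc (x k) <= d.
  move=> kN; rewrite /d (bigD1 (Ordinal kN))//= lerDl.
  by apply: sumr_ge0 => j _; exact: normc_ge0.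
apply: le_lt_trans (lp_norm_truncate_bound d0 xd) _.
by rewrite lte_mul_pinfty ?lee_fin// lp_norm_truncate1.
Qed.

Lemma seq_lp (s : seq R[i]) : (fun k => nth 0 s k : R[i]^o) \in lp_pred p.
Proof. by apply: (finite_support_lp (size s)) => k /(nth_default _). Qed.

Definition lp_seq (s : seq R[i]) : lp p1 := Lp p1 (seq_lp s).

(** For finite p the norm of the tail is the p-th root of the remainder of a
    convergent series; for p = +oo this fails, e.g. for a constant sequence. *)
Lemma lp_tail_le (x : lp p1) {e : R} : (p < +oo)%E -> 0 < e ->
  exists N, (lp_norm p (fun k => x k - truncate N x k : R[i])%R <= e%:E)%E.
Proof.
have := lp_norm_lty x; case: p p1 x => [r r1 x xoo _ e0| |//]; last by [].
have r0 : 0 < r by rewrite -lte_fin (lt_le_trans _ r1)// lte_fin.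
pose g k : \bar R := (Normc.normc (x k) `^ r)%:E.
have g0 k : (0 <= g k)%E by rewrite lee_fin powR_ge0.
have G0 : (0 <= \sum_(0 <= k <oo) g k)%E by apply: nneseries_ge0.
have goo : (\sum_(0 <= k <oo) g k < +oo)%E.
  move: xoo; rewrite lp_norm_EFin// => xoo.
  rewrite -[ltLHS](_ : ((\sum_(0 <= k <oo) g k) `^ r^-1 `^ r)%E = _).
    by rewrite poweR_lty.
  by rewrite -poweRrM mulVf ?gt_eqF// poweRe1.
have := nneseries_tail_cvg goo (fun k _ => g0 k).
have er0 : 0 < e `^ r by rewrite powR_gt0.
move=> /fine_cvgP[gfin] /cvgr0Pnorm_lt/(_ _ er0) glt.
have [N [Nfin Nlt]] : exists N,
    (\sum_(N <= k <oo) g k \is a fin_num)%E /\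
    `|fine (\sum_(N <= k <oo) g k)%E| < e `^ r.
  have [N _ NP] : \forall N \near \oo,
    (\sum_(N <= k <oo) g k \is a fin_num)%E /\
    `|fine (\sum_(N <= k <oo) g k)%E| < e `^ r.
    near=> N; split; near: N; [exact: gfin|exact: glt].
  by exists N; apply: NP => /=.
exists N; rewrite lp_norm_EFin//.
have -> : (\sum_(k <oo) (Normc.normc (x k - truncate N x k) `^ r)%:E)%E =
    (\sum_(N <= k <oo) g k)%E.
  rewrite [LHS](nneseries_split _ N); last first.
    by move=> k _; rewrite lee_fin powR_ge0.
  rewrite add0n big_nat big1 ?add0e => [|k /andP[_ kN]].
    apply: congr_lim; apply/funext => n; apply: eq_big_nat => k /andP[Nk _].
    by rewrite /truncate ltnNge Nk subr0.
  by rewrite /truncate kN subrr Normc.normc0 powR0// gt_eqF.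
have -> : (e%:E = (e%:E `^ r) `^ r^-1)%E.
  by rewrite -poweRrM mulfV ?gt_eqF// poweRe1// lee_fin ltW.
apply: gt0_ler_poweR.
- by rewrite invr_ge0 ltW.
- by rewrite in_itv/= leey nneseries_ge0.
- by rewrite in_itv/= leey lee_fin powR_ge0.
by rewrite -(fineK Nfin) poweR_EFin lee_fin (le_trans (ler_norm _))// ltW.
Unshelve. all: by end_near. Qed.

Lemma ratc_dense (z : R[i]) {d : R} : 0 < d ->
  exists q : rat * rat, Normc.normc (z - (ratr q.1 +i* ratr q.2)%C) <= d.
Proof.
move=> d0; have d20 : 0 < d / 2 by rewrite divr_gt0.
have approx (t : R) : exists q : rat, `|t - ratr q| <= d / 2.
  have [||v [/= tq [q _ qv]]] := @dense_rat R (ball t (d / 2)).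
  - by exists t; exact: ballxx.
  - exact: ball_open.
  by exists q; move: tq; rewrite -qv -ball_normE => /ltW.
case: z => t s; have [q1 h1] := approx t; have [q2 h2] := approx s.
exists (q1, q2); rewrite -lecR -normcE.
apply: (@le_trans _ R[i] _ _ _ (le_normc_ReIm _)).
by rewrite lecR /= [leRHS]splitr lerD.
Qed.

Lemma separable_lp : (p < +oo)%E -> separable (lp p1).
Proof.
move=> poo.
pose toC (q : rat * rat) : R[i] := (ratr q.1 +i* ratr q.2)%C.
exists (range (fun s : seq (rat * rat) => lp_seq (map toC s))).
  exact: sub_countable (card_image_le _ _) (countableP _).
move=> O [x Ox]; rewrite openE => /(_ _ Ox)/nbhs_ballP[e' /= e'0 xO].
have [e e0 eE] := gt0_complexE e'0.
have e40 : 0 < e / 4 by rewrite divr_gt0.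
have [N xN] := lp_tail_le x poo e40.
set C := fine (lp_norm p (truncate N (fun=> 1%R : R[i]))).
have CE : lp_norm p (truncate N (fun=> 1%R : R[i])) = C%:E.
  by rewrite fineK// ge0_fin_numE ?lp_norm_ge0// lp_norm_truncate1.
have C0 : 0 <= C by rewrite fine_ge0 ?lp_norm_ge0.
(* Dividing by C + 1 avoids the case C = 0, which occurs for N = 0. *)
have d0 : 0 < e / 4 / (C + 1) by rewrite divr_gt0 ?ltr_wpDl.
have /choice[q qP] k := ratc_dense (x k) d0.
pose s := mkseq q N; exists (lp_seq (map toC s)); split; last by exists s.
apply: xO; rewrite -ball_normE /= lp_normrE eE ltcR.
rewrite -lte_fin fineK; last exact: (lp_norm_fin (x - lp_seq (map toC s))).
apply: (@le_lt_trans _ _ (e / 4 + e / 4)%:E); last first.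
  by rewrite lte_fin; lra.
have -> : (x - lp_seq (map toC s) : nat -> R[i]) =
    (fun k => x k - truncate N x k : R[i]) +
    truncate N (fun k => x k - toC (q k)).
  apply/funext => k.
  change (x k - nth 0 (map toC s) k =
    (x k - truncate N x k) + truncate N (fun k => x k - toC (q k)) k).
  rewrite /truncate; case: ltnP => kN.
    by rewrite (nth_map 0) ?size_mkseq// nth_mkseq// subrr add0r.
  by rewrite nth_default ?addr0// size_map size_mkseq.
apply: le_trans (lp_normD p1 _ _) _; rewrite EFinD; apply: leeD => //.
apply: (le_trans (lp_norm_truncate_bound (ltW d0) (fun k _ => qP k))).
rewrite CE -EFinM lee_fin mulrAC ler_pdivrMr ?ltr_wpDl// ler_pM2l//.
by rewrite lerDl.
Qed.

End FiniteSupport.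

(** * Dynamics of the diagonal pair *)

Section DiagonalPairDynamics.
Context {R : realType} {p : \bar R} (p1 : (1 <= p)%E) (a b c : R[i]).
Local Notation T := (diag_pair p1 a b c).

Lemma pair_iter_diag (k l : nat) (x : lp p1) (n : nat) :
  pair_iter T k l x n =
    (if n == 0%N then a ^+ k * b ^+ l else c ^+ (k + l)) * x n :> R[i].
Proof.
have iterE d m (y : lp p1) : iter m (diag_op d c) y n =
    (if n == 0%N then d ^+ m else c ^+ m) * y n :> R[i].
  elim: m => [|m IH] /=; first by rewrite !expr0 if_same mul1r.
  rewrite /diag_seq; move: IH; case: eqP => [->|_] ->;
    by rewrite exprS mulrA.
rewrite /pair_iter [LHS]iterE iterE.
by case: ifP => _; rewrite mulrA ?exprD.
Qed.

Hypothesis c1 : 1 < `|c|.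

Lemma pair_iter_expand (k l : nat) (x : lp p1) (n : nat) :
  `|x n.+1| <= `|pair_iter T k l x n.+1| :> R[i].
Proof.
rewrite pair_iter_diag /= normrM normrX ler_peMl//.
by rewrite exprn_ege1// ltW.
Qed.

Lemma norm_coordB (x y : lp p1) (n : nat) (e : R[i]) :
  ball x e y -> `|x n - y n| < e :> R[i].
Proof.
rewrite -ball_normE /=; apply: le_lt_trans.
by rewrite -lpBE; exact: norm_coord_le.
Qed.

Let e1 : lp p1 := lp_seq p1 [:: 0; 1].

(** The ball around e1 consists of vectors with second coordinate larger than
    1 / 2 in modulus, which expansion keeps out of the ball around 0. *)
Lemma diag_pair_not_transitive : ~ topologically_transitive T.
Proof.
have h0 : 0 < 1 / 2 :> R[i] by rewrite divr_gt0.
move=> /(_ (ball e1 (1 / 2)) (ball 0 (1 / 2))) [].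
- exact: ball_open.
- by exists e1; exact: ballxx.
- exact: ball_open.
- by exists 0; exact: ballxx.
move=> k [l [_ [[u e1u <-]]]] /(norm_coordB _ _ 1) uk.
have := norm_coordB _ _ 1 _ e1u.
have := pair_iter_expand k l u 0; move: uk.
rewrite sub0r normrN => uk /le_lt_trans/(_ uk) u1 eu1.
have : `|1 : R[i]| < 1 / 2 + 1 / 2.
  rewrite -[X in `|X|](subrK (u 1%N : R[i])).
  by apply: le_lt_trans (ler_normD _ _) _; exact: ltrD.
by rewrite normr1 -splitr ltxx.
Qed.

(** An orbit with zero second coordinate misses the unit ball around e1, and any
    other orbit stays away from 0. *)
Lemma diag_pair_not_hypercyclic : ~ hypercyclic T.
Proof.
move=> [x xD]; have [x1|x1] := eqVneq (x 1%N : R[i]) 0.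
  have [||v [/= /(norm_coordB _ _ 1) + [k [l vE]]]] := xD (ball e1 1).
  - by exists e1; exact: ballxx.
  - exact: ball_open.
  by rewrite vE pair_iter_diag x1 mulr0 subr0 normr1 ltxx.
have x1_gt0 : 0 < `|x 1%N : R[i]| by rewrite normr_gt0.
have [||v [/= /(norm_coordB _ _ 1) + [k [l vE]]]] :=
  xD (ball 0 `|x 1%N : R[i]|).
- by exists 0; exact: ballxx.
- exact: ball_open.
rewrite vE sub0r normrN => /(le_lt_trans (pair_iter_expand k l x 0)).
by rewrite ltxx.
Qed.

Lemma cvg_coord (u : nat -> lp p1) (x : lp p1) (n : nat) :
  u m @[m --> \oo] --> x -> (u m n : R[i]^o) @[m --> \oo] --> x n.
Proof.
move=> /cvgrPdist_lt ux; apply/cvgrPdist_lt => e /ux; apply: filterS => m.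
by apply: le_lt_trans; rewrite -lpBE; exact: norm_coord_le.
Qed.

(** Running the iteration backwards: u_m(n) = c^-(k_m+l_m) (T1^(k_m) T2^(l_m) u_m)(n)
    is the product of a null sequence and a convergent one. *)
Lemma extended_limit_set_coord0 (x y : lp p1) (n : nat) :
  extended_limit_set T x y -> x n.+1 = 0.
Proof.
move=> [u [k [l [ux kl Tuy]]]].
have c0 : c != 0 by rewrite -normr_gt0 (lt_trans ltr01).
have cK : (c^-1 ^+ (k m + l m) : R[i]^o) @[m --> \oo] --> (0 : R[i]^o).
  by apply: cvg_comp kl _; exact: cvg_complex_exprV.
have uE : (fun m => u m n.+1 : R[i]^o) = (fun m =>
    c^-1 ^+ (k m + l m) * (pair_iter T (k m) (l m) (u m) n.+1 : R[i]^o)).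
  apply/funext => m; rewrite pair_iter_diag /= mulrA exprVn mulVf ?mul1r//.
  by rewrite expf_neq0.
have := cvg_coord _ _ n.+1 ux; rewrite uE => ux'.
have := cvgM cK (cvg_coord _ _ n.+1 Tuy); rewrite mul0r => /(_ _).
exact: norm_cvg_unique ux'.
Qed.

Hypothesis hab : dense [set z : R[i]^o | exists k l : nat,
                    [/\ (0 < k)%N, (0 < l)%N & z = a ^+ k * b ^+ l]].

Let e0 : lp p1 := lp_seq p1 [:: 1].

(** The approximating vector has first coordinate w, near z, and the coordinates
    of y divided by c^(k+l) elsewhere; its image differs from y only in the
    first coordinate, by a^k b^l w - y_1. *)
Lemma extended_limit_set_axis (x : lp p1) (z : R[i]) :
  (forall n, x n = if n == 0%N then z else 0) -> extended_limit_set T x = setT.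
Proof.
move=> xz; apply/seteqP; split=> // y _; apply: mem_extended_limit_set.
move=> e N e_gt0.
have e0E n : e0 n = (n == 0%N)%:R :> R[i] by case: n => [|[]].
have e0_gt0 : 0 < `|e0|.
  by rewrite (lt_le_trans _ (norm_coord_le e0 0))// normr1.
have h0 : 0 < e / 2 / `|e0| by rewrite !divr_gt0.
(* The first coordinate must not vanish, or its orbit would stay at 0. *)
have [w w0 wz] : exists2 w : R[i], w != 0 & `|w - z| * `|e0| <= e / 2.
  have [->|z0] := eqVneq z 0; last first.
    by exists z; rewrite // subrr normr0 mul0r ltW// divr_gt0.
  exists (e / 2 / `|e0|); first by rewrite gt_eqF.
  by rewrite subr0 gtr0_norm// divfK// gt_eqF.
(* y' is y with its first coordinate erased. *)
pose y' : lp p1 := diag_op 0 1 y.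
have [M MP] : exists M, forall n, (M <= n)%N -> `|c^-1 ^+ n| * `|y'| < e / 2.
  have y'0 : 0 < `|y'| + 1 by rewrite ltr_wpDl.
  have d0 : 0 < e / 2 / (`|y'| + 1) by rewrite !divr_gt0.
  have /cvgr0Pnorm_lt/(_ _ d0)[M _ MP] := cvg_complex_exprV c1.
  exists M => n /MP /=; rewrite ltr_pdivlMr//; apply: le_lt_trans.
  by rewrite ler_wpM2l// lerDl.
have we0 : 0 < `|w| * `|e0| by rewrite mulr_gt0 ?e0_gt0 ?normr_gt0.
have [k [l [kl abkl]]] :=
  dense_mulX_tail hab (maxn M N) (y 0%N / w) (divr_gt0 e_gt0 we0).
exists (w *: e0 + c^-1 ^+ (k + l) *: y'), k, l.
move: kl; rewrite geq_max => /andP[Mkl Nkl]; split => //.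
- have -> : w *: e0 + c^-1 ^+ (k + l) *: y' - x =
      (w - z) *: e0 + c^-1 ^+ (k + l) *: y'.
    apply: lpP => n; rewrite !(lpDE, lpNE, lpZE) xz e0E.
    rewrite addrAC; congr (_ + _); rewrite mulrBl; congr (_ - _).
    by case: eqP => _; rewrite ?mulr1 ?mulr0.
  apply: le_lt_trans (ler_normD _ _) _; rewrite !normrZ.
  by rewrite [ltRHS](@splitr R[i]) ler_ltD ?MP.
have -> : pair_iter T k l (w *: e0 + c^-1 ^+ (k + l) *: y') - y =
    ((a ^+ k * b ^+ l - y 0%N / w) * w) *: e0.
  apply: lpP => n; rewrite lpBE lpZE pair_iter_diag lpDE !lpZE !e0E.
  rewrite /y' /= /diag_seq; case: eqP => [->|_].
    by rewrite mul0r mulr0 addr0 !mulr1 mulrBl divfK.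
  rewrite !mulr0 add0r mul1r mulrA exprVn mulfV ?mul1r ?subrr//.
  by rewrite expf_neq0// -normr_gt0 (lt_trans ltr01).
by rewrite normrZ normrM -mulrA -ltr_pdivlMr.
Qed.

Lemma extended_limit_set_full :
  [set x : lp p1 | extended_limit_set T x = setT] =
  [set x : lp p1 | exists z : R[i], forall n, x n = if n == 0%N then z else 0].
Proof.
apply/seteqP; split => x /=; last by move=> [z /extended_limit_set_axis].
move=> Jx; exists (x 0%N); case=> [//|n] /=.
by apply: (@extended_limit_set_coord0 x 0); rewrite Jx.
Qed.

Lemma diag_pair_locally_transitive : locally_topologically_transitive T.
Proof.
exists e0; last first.
  by apply: (@extended_limit_set_axis _ 1); case=> [|[]].
apply/eqP => /(congr1 (fun x : lp p1 => x 0%N : R[i])) /eqP.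
by rewrite (oner_eq0 R[i]).
Qed.

End DiagonalPairDynamics.

Theorem theorem4p1 (R : realType) (a b c : R[i])
    (hab : dense [set z : R[i]^o | exists k l : nat,
                    [/\ (0 < k)%N, (0 < l)%N & z = a ^+ k * b ^+ l]])
    (hc : 1 < `|c|) :
  [/\ forall (p : \bar R) (p1 : (1 <= p)%E), (p < +oo)%E ->
        locally_hypercyclic (diag_pair p1 a b c) /\
        ~ hypercyclic (diag_pair p1 a b c),
      locally_topologically_transitive (diag_pair (leey 1%E) a b c) /\
      ~ topologically_transitive (diag_pair (leey 1%E) a b c)
    & forall (p : \bar R) (p1 : (1 <= p)%E),
        [set x : lp p1 | extended_limit_set (diag_pair p1 a b c) x = setT] =
        [set x : lp p1 | exists x1 : R[i],
           forall n : nat, x n = if n == 0%N then x1 else 0]].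
Proof.
split.
- move=> p p1 poo; split; last exact: diag_pair_not_hypercyclic.
  by split; [exact: diag_pair_locally_transitive|exact: separable_lp].
- split; first exact: diag_pair_locally_transitive.
  exact: diag_pair_not_transitive.
by move=> p p1; exact: extended_limit_set_full.
Qed.
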